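(* Let $p:X\to Y$ be a continuous surjective map with $X$ connected and $Y$ a topological group. Suppose there is an open neighborhood $U$ of $1_Y$ such that $\mathcal U=\{U\cdot y\}_{y\in Y}$ is an overlay cover of $Y$ for $p$, and that $p$ has a regular overlay structure. Then there is a structure of a topological group on $X$ (compatible with its topology) making $p$ a continuous homomorphism.
   Context: For a continuous map $p:X\to Y$: a slice of $p$ is an open set $U\subseteq X$ such that $p^{-1}(p(U))$ is the disjoint union of a family of open sets $U_s$ ($s\in S$), each mapped by $p$ homeomorphically onto $p(U)$, with $U=U_t$ for some $t\in S$. A covering structure of $p$ is an open cover $\mathcal S$ of $X$ by slices of $p$ such that for every $U\in\mathcal S$, $p^{-1}(p(U))$ is the disjoint union of a family $\{U_j\}_{j\in J}$ of elements of $\mathcal S$, each mapped homeomorphically onto $p(U)$. For $x\in X$, $st(x,\mathcal S)=\bigcup\{U\in\mathcal S: x\in U\}$. An overlay structure of $p$ is a covering structure $\mathcal S$ such that $st(x,\mathcal S)$ is a slice of $p$ for every $x\in X$; a cover of the form $p(\mathcal S)=\{p(V):V\in\mathcal S\}$ with $\mathcal S$ an overlay structure is an overlay cover of $Y$. For a cover $\mathcal W$ of a set $Z$, a $\mathcal W$-chain is a finite sequence $\{z_0,\dots,z_n\}$ such that for each $0\le i<n$ some $W\in\mathcal W$ contains $z_i$ and $z_{i+1}$; it is a $\mathcal W$-loop if $z_0=z_n$. A lift of $\{y_0,\dots,y_n\}$ is a sequence $\{x_0,\dots,x_n\}$ with $p(x_i)=y_i$. An overlay structure $\mathcal S$ with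 overlay cover $\mathcal U$ is regular if there is no $\mathcal U$-loop having one lift that is an $\mathcal S$-chain which is a loop and another lift that is an $\mathcal S$-chain which is not a loop. (For connected $X$, if one overlay structure of $p$ is regular then all are.) *)

(* Defs.v *)
Set Implicit Arguments.

Definition set (T : Type) := T -> Prop.

Definition set_eq {T : Type} (A B : set T) : Prop := forall x, A x <-> B x.

Definition image {X Y : Type} (p : X -> Y) (A : set X) : set Y :=
  fun y => exists x, A x /\ p x = y.

Definition preimage {X Y : Type} (p : X -> Y) (B : set Y) : set X :=
  fun x => B (p x).

Record Topology (T : Type) := {
  is_open : set T -> Prop;
  open_full : is_open (fun _ => True);
  open_inter : forall A B, is_open A -> is_open B -> is_open (fun x => A x /\ B x);
  open_union : forall (F : set (set T)), (forall A, F A -> is_open A) ->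
                 is_open (fun x => exists A, F A /\ A x)
}.

Definition continuous {X Y : Type} (TX : Topology X) (TY : Topology Y) (f : X -> Y) :=
  forall W, is_open TY W -> is_open TX (preimage f W).

Definition surjective {X Y : Type} (f : X -> Y) := forall y, exists x, f x = y.

Definition connected {X : Type} (TX : Topology X) :=
  forall A B : set X, is_open TX A -> is_open TX B ->
    (forall x, A x \/ B x) -> (forall x, ~ (A x /\ B x)) ->
    (exists x, A x) -> (exists x, B x) -> False.

(* p restricted to A is a homeomorphism of the subspace A of X onto the
   subspace p(A) of Y: injective on A, continuous and open w.r.t. the
   subspace topologies. *)
Definition homeo_onto_image {X Y : Type} (TX : Topology X) (TY : Topology Y)
    (p : X -> Y) (A : set X) : Prop :=
  (forall x x', A x -> A x' -> p x = p x' -> x = x') /\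
  (forall W, is_open TY W -> exists V, is_open TX V /\
       forall x, A x -> (V x <-> W (p x))) /\
  (forall V, is_open TX V -> exists W, is_open TY W /\
       forall y, image p A y -> (image p (fun x => A x /\ V x) y <-> W y)).

Definition sheet_decomposition {X Y : Type} (TX : Topology X) (TY : Topology Y)
    (p : X -> Y) (U : set X) (S : Type) (Us : S -> set X) : Prop :=
  (forall s, is_open TX (Us s)) /\
  (forall s s' x, Us s x -> Us s' x -> s = s') /\
  (forall x, (exists s, Us s x) <-> preimage p (image p U) x) /\
  (forall s, homeo_onto_image TX TY p (Us s) /\ set_eq (image p (Us s)) (image p U)).

Definition slice {X Y : Type} (TX : Topology X) (TY : Topology Y)
    (p : X -> Y) (U : set X) : Prop :=
  is_open TX U /\
  exists (S : Type) (Us : S -> set X) (t : S),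
    sheet_decomposition TX TY p U Us /\ set_eq (Us t) U.

Definition covering_structure {X Y : Type} (TX : Topology X) (TY : Topology Y)
    (p : X -> Y) (S : set (set X)) : Prop :=
  (forall U, S U -> slice TX TY p U) /\
  (forall x, exists U, S U /\ U x) /\
  (forall U, S U -> exists (J : Type) (Uj : J -> set X),
      (forall j, S (Uj j)) /\ sheet_decomposition TX TY p U Uj).

Definition star {X : Type} (x : X) (S : set (set X)) : set X :=
  fun z => exists U, S U /\ U x /\ U z.

Definition overlay_structure {X Y : Type} (TX : Topology X) (TY : Topology Y)
    (p : X -> Y) (S : set (set X)) : Prop :=
  covering_structure TX TY p S /\ forall x, slice TX TY p (star x S).

(* W-chains: sequences z_0, ..., z_n (given as z : nat -> Z, only indices <= n
   matter). *)
Definition chain {Z : Type} (W : set (set Z)) (n : nat) (z : nat -> Z) : Prop :=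
  forall i, i < n -> exists A, W A /\ A (z i) /\ A (z (S i)).

Definition image_cover {X Y : Type} (p : X -> Y) (S : set (set X)) : set (set Y) :=
  fun B => exists V, S V /\ set_eq B (image p V).

Definition regular_overlay {X Y : Type} (p : X -> Y) (S : set (set X)) : Prop :=
  ~ exists (n : nat) (y : nat -> Y) (x x' : nat -> X),
      chain (image_cover p S) n y /\ y 0 = y n /\
      (forall i, i <= n -> p (x i) = y i) /\
      (forall i, i <= n -> p (x' i) = y i) /\
      chain S n x /\ x 0 = x n /\
      chain S n x' /\ x' 0 <> x' n.

Record GroupStr (G : Type) := {
  gmul : G -> G -> G;
  ginv : G -> G;
  gone : G;
  gmulA : forall a b c, gmul a (gmul b c) = gmul (gmul a b) c;
  gmul1g : forall a, gmul gone a = a;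
  gmulg1 : forall a, gmul a gone = a;
  gmulVg : forall a, gmul (ginv a) a = gone;
  gmulgV : forall a, gmul a (ginv a) = gone
}.

(* Multiplication continuous G x G -> G (product topology, tested on basic
   boxes) and inversion continuous. *)
Definition topological_group {G : Type} (T : Topology G) (g : GroupStr G) : Prop :=
  (forall W a b, is_open T W -> W (gmul g a b) ->
     exists A B, is_open T A /\ is_open T B /\ A a /\ B b /\
       forall a' b', A a' -> B b' -> W (gmul g a' b')) /\
  continuous T T (ginv g).

Definition rtranslate {G : Type} (g : GroupStr G) (U : set G) (y : G) : set G :=
  fun z => exists u, U u /\ z = gmul g u y.

Definition is_overlay_cover_translates {X Y : Type} (TX : Topology X) (TY : Topology Y)
    (p : X -> Y) (g : GroupStr Y) (U : set Y) : Prop :=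
  exists S, overlay_structure TX TY p S /\
    (forall V, S V -> exists y, set_eq (image p V) (rtranslate g U y)) /\
    (forall y, exists V, S V /\ set_eq (image p V) (rtranslate g U y)).

(* Main.v *)
From Stdlib Require Import Classical ClassicalEpsilon.
From Stdlib Require Import FunctionalExtensionality PropExtensionality.
Require Import Defs.

(** Write [W = U U^-1] and let [S] be an overlay structure whose images are the
    translates of [U].  For [s] in [W] the points [y] and [s y] lie in a common
    translate of [U], so the star condition yields a unique lift [tau s x] of
    [s (p x)] sharing a member of [S] with [x], and [tau] is jointly continuous.
    Consider all continuous lifts to [X] of left translations of [Y].  As [p] is
    a covering and [X] is connected, such a lift is determined by one value; as
    the orbits under composition with the [tau s] are open, the lifts act
    transitively on [X].  Hence they act simply transitively, and identifying a
    lift [f] with [f e], where [e] lies over the unit, transports composition to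
    a group law on [X]. *)

(** * Topological preliminaries *)

(** [A] is the union of its open subsets; extensionality turns this into an equality of predicates,
    which [is_open] can be rewritten along. *)
Lemma open_of_local {T : Type} (TT : Topology T) (A : set T) :
  (forall x, A x -> exists O, is_open TT O /\ O x /\ forall z, O z -> A z) ->
  is_open TT A.
Proof.
intros H.
assert (E : A = fun x => exists O, (is_open TT O /\ forall z, O z -> A z) /\ O x).
{ apply functional_extensionality; intros x; apply propositional_extensionality.
  split.
  - intros Ax; destruct (H x Ax) as [O [HO [Ox OA]]]; exists O; auto.
  - intros [O [[_ OA] Ox]]; auto. }
rewrite E.
apply (open_union TT (fun O => is_open TT O /\ forall z, O z -> A z)).
intros O [HO _]; exact HO.
Qed.

Lemma continuous_comp {A B C : Type} {TA : Topology A} {TB : Topology B}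
    {TC : Topology C} (f : B -> C) (g : A -> B) :
  continuous TB TC f -> continuous TA TB g ->
  continuous TA TC (fun x => f (g x)).
Proof. intros cf cg O HO; exact (cg _ (cf _ HO)). Qed.

Lemma continuous_id {T : Type} (TT : Topology T) : continuous TT TT (fun x => x).
Proof. intros O HO; exact HO. Qed.

Lemma connected_clopen {T : Type} (TT : Topology T) (A : set T) (a : T) :
  connected TT -> is_open TT A -> is_open TT (fun x => ~ A x) -> A a ->
  forall x, A x.
Proof.
intros conn oA oA' Aa x.
apply NNPP; intros nAx.
apply (conn A (fun x => ~ A x)); eauto.
- intros z; apply classic.
- tauto.
Qed.

Lemma slice_inj {X Y : Type} (TX : Topology X) (TY : Topology Y) (p : X -> Y)
    (V : set X) (x x' : X) :
  slice TX TY p V -> V x -> V x' -> p x = p x' -> x = x'.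
Proof.
intros [_ [I [Us [t [[_ [_ [_ hom]]] Et]]]]] Vx Vx'.
destruct (hom t) as [[inj _] _].
apply inj; apply Et; assumption.
Qed.

(** The agreement set is clopen: it is open because [p] is injective on slices, and its complement
    is open because two distinct points of a fibre lie in disjoint sheets. *)
Lemma covering_lift_unique {X Y Z : Type} (TX : Topology X) (TY : Topology Y)
    (TZ : Topology Z) (p : X -> Y) (S : set (set X)) (f f' : Z -> X) (z0 : Z) :
  covering_structure TX TY p S -> connected TZ ->
  continuous TZ TX f -> continuous TZ TX f' ->
  (forall z, p (f z) = p (f' z)) -> f z0 = f' z0 ->
  forall z, f z = f' z.
Proof.
intros [sl [cov _]] conn cf cf' pff' E0.
apply (connected_clopen TZ (fun z => f z = f' z) z0); auto.
- apply open_of_local; intros z Ez.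
  destruct (cov (f z)) as [V [SV Vz]].
  assert (slV := sl V SV).
  exists (fun w => preimage f V w /\ preimage f' V w); split; [|split].
  + apply open_inter; [apply cf | apply cf']; apply slV.
  + split; [exact Vz | unfold preimage; rewrite <- Ez; exact Vz].
  + intros w [Vw Vw']; apply (slice_inj _ _ _ _ _ _ slV Vw Vw'); apply pff'.
- apply open_of_local; intros z Nz.
  destruct (cov (f z)) as [V [SV Vz]].
  destruct (sl V SV) as [_ [I [Us [t [[op [disj [un hom]]] _]]]]].
  destruct (proj2 (un (f z))) as [i Ui]; [exists (f z); auto|].
  destruct (proj2 (un (f' z))) as [j Uj]; [exists (f z); auto|].
  exists (fun w => preimage f (Us i) w /\ preimage f' (Us j) w); split; [|split].
  + apply open_inter; [apply cf | apply cf']; apply op.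
  + split; assumption.
  + intros w [Uw Uw'] Ew; unfold preimage in Uw, Uw'; rewrite <- Ew in Uw'.
    apply Nz; apply (proj1 (proj1 (hom i))); auto.
    rewrite (disj i j _ Uw Uw'); exact Uj.
Qed.

(** Stars are slices: this is the property of overlays that makes [tau] unambiguous, whichever
    member of [S] is used. *)
Lemma overlay_star_inj {X Y : Type} (TX : Topology X) (TY : Topology Y)
    (p : X -> Y) (S : set (set X)) (x a b : X) :
  overlay_structure TX TY p S -> star x S a -> star x S b -> p a = p b -> a = b.
Proof. intros [_ st]; exact (slice_inj _ _ _ _ _ _ (st x)). Qed.

(** * Groups *)

Section Group.
Context {G : Type} (g : GroupStr G).
Local Infix "*" := (gmul g).
Local Notation "x ^-1" := (ginv g x) (at level 3, left associativity, format "x ^-1").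

Lemma gmulK a b : (a * b) * b^-1 = a.
Proof. now rewrite <- gmulA, gmulgV, gmulg1. Qed.

Lemma gmulVK a b : (a * b^-1) * b = a.
Proof. now rewrite <- gmulA, gmulVg, gmulg1. Qed.

Lemma gmulKl a b : a^-1 * (a * b) = b.
Proof. now rewrite gmulA, gmulVg, gmul1g. Qed.

Lemma gmul_right_inj a b c : a * c = b * c -> a = b.
Proof. intros E; rewrite <- (gmulK a c), E; apply gmulK. Qed.

Lemma gmul_div_trans a b z : (a * z) * (b * z)^-1 = a * b^-1.
Proof.
apply (gmul_right_inj _ _ (b * z)).
now rewrite gmulVK, <- gmulA, gmulKl.
Qed.

Lemma rtranslate_open (T : Topology G) (U : set G) (y : G) :
  topological_group T g -> is_open T U -> is_open T (rtranslate g U y).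
Proof.
intros [mulc _] oU; apply open_of_local; intros z [u [Uu ->]].
destruct (mulc U (u * y) y^-1 oU) as [A [B [oA [oB [Aa [Bb AB]]]]]].
{ now rewrite gmulK. }
exists A; split; [exact oA | split; [exact Aa|]].
intros w Aw; exists (w * y^-1); split; [exact (AB _ _ Aw Bb) | now rewrite gmulVK].
Qed.

Definition quotients (U : set G) : set G :=
  fun s => exists u v, U u /\ U v /\ s = u * v^-1.

Lemma quotients_rtranslate (U : set G) (s y : G) :
  quotients U s -> exists z, rtranslate g U z y /\ rtranslate g U z (s * y).
Proof.
(* With [z = v^-1 * y] one has [y = v * z] and [u * v^-1 * y = u * z]. *)
intros [u [v [Uu [Uv ->]]]]; exists (v^-1 * y); split.
- exists v; split; [exact Uv|]. now rewrite gmulA, gmulgV, gmul1g.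
- exists u; split; [exact Uu|]. now rewrite gmulA.
Qed.

End Group.

(** * Lifting left translations *)

Section Lifts.
Context {X Y : Type} (TX : Topology X) (TY : Topology Y) (gY : GroupStr Y)
  (p : X -> Y) (U : set Y) (S : set (set X)) (tau : Y -> X -> X).
Local Infix "*" := (gmul gY).
Local Notation "x ^-1" := (ginv gY x) (at level 3, left associativity, format "x ^-1").

Hypothesis tgY : topological_group TY gY.
Hypothesis pC : continuous TX TY p.
Hypothesis Xconn : connected TX.
Hypothesis oU : is_open TY U.
Hypothesis ovS : overlay_structure TX TY p S.
Hypothesis S_image : forall V, S V -> exists y, set_eq (image p V) (rtranslate gY U y).

Let W := quotients gY U.

Hypothesis tauP : forall s x, W s -> star x S (tau s x) /\ p (tau s x) = s * p x.

Lemma star_quotient x x' : star x S x' -> W (p x' * (p x)^-1).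
Proof.
intros [V [SV [Vx Vx']]]; destruct (S_image V SV) as [z Ez].
destruct (proj1 (Ez (p x))) as [v [Uv ->]]; [exists x; auto|].
destruct (proj1 (Ez (p x'))) as [u [Uu ->]]; [exists x'; auto|].
exists u, v; repeat split; auto; apply gmul_div_trans.
Qed.

Lemma tau_star x x' : star x S x' -> tau (p x' * (p x)^-1) x = x'.
Proof.
intros xx'; destruct (tauP _ x (star_quotient _ _ xx')) as [st Ep].
apply (overlay_star_inj _ _ _ _ x _ _ ovS st xx').
now rewrite Ep, gmulVK.
Qed.

Lemma quotients_one (x : X) : W (gone gY).
Proof.
destruct (proj1 (proj2 (proj1 ovS)) x) as [V [SV Vx]].
rewrite <- (gmulgV gY (p x)); apply star_quotient; exists V; auto.
Qed.

Lemma tau_one x : tau (gone gY) x = x.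
Proof.
destruct (proj1 (proj2 (proj1 ovS)) x) as [V [SV Vx]].
rewrite <- (gmulgV gY (p x)) at 1; apply tau_star; exists V; auto.
Qed.

Lemma preimage_div_l_open a (A : set Y) :
  is_open TY A -> is_open TX (fun a' => A (p a' * (p a)^-1)).
Proof.
intros oA; apply open_of_local; intros x Ax.
destruct (proj1 tgY A _ _ oA Ax) as [B [C [oB [_ [Bx [Ca BC]]]]]].
exists (preimage p B); split; [exact (pC _ oB) | split; [exact Bx|]].
intros z Bz; exact (BC _ _ Bz Ca).
Qed.

Lemma preimage_div_r_open a (A : set Y) :
  is_open TY A -> is_open TX (fun a' => A (p a * (p a')^-1)).
Proof.
intros oA; apply open_of_local; intros x Ax.
destruct (proj1 tgY A _ _ oA Ax) as [B [C [_ [oC [Ba [Cx BC]]]]]].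
exists (preimage p (preimage (ginv gY) C)); split; [|split; [exact Cx|]].
- apply pC, (proj2 tgY), oC.
- intros z Cz; exact (BC _ _ Ba Cz).
Qed.

(** If [V] in [S] contains [x] and [tau s x], then near [(s, x)] the map [tau] is the local inverse
    of [p] on [V] applied to [s' * p x']. *)
Lemma tau_joint_continuous (s : Y) (x : X) (O : set X) :
  W s -> is_open TX O -> O (tau s x) ->
  exists A B, is_open TY A /\ is_open TX B /\ A s /\ B x /\
    forall s' x', W s' -> A s' -> B x' -> O (tau s' x').
Proof.
intros Ws oO Ox.
destruct (tauP s x Ws) as [[V [SV [Vx Vt]]] Ep].
destruct (proj1 (proj1 ovS) V SV) as [oV [I [Us [t [[_ [_ [_ hom]]] Et]]]]].
destruct (hom t) as [[_ [_ op]] _].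
destruct (op O oO) as [N [oN HN]].
destruct (S_image V SV) as [z Ez].
assert (oVz := rtranslate_open gY TY U z tgY oU).
assert (toUs : forall y, rtranslate gY U z y -> image p (Us t) y).
{ intros y Hy; destruct (proj2 (Ez y) Hy) as [v [Vv <-]].
  exists v; split; [apply Et|]; auto. }
(* Within the open set [p(V)], a translate of [U], the set [N] cuts out the image of the part of [V]
   in [O]. *)
destruct (proj1 tgY (fun y => N y /\ rtranslate gY U z y) s (p x))
  as [A [B [oA [oB [As [Bx AB]]]]]].
{ apply open_inter; assumption. }
{ rewrite <- Ep.
  assert (Hz : rtranslate gY U z (p (tau s x))) by (apply Ez; exists (tau s x); auto).
  split; [|exact Hz].
  apply HN; [apply toUs, Hz|].
  exists (tau s x); split; [split; [apply Et|]|]; auto. }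
exists A, (fun w => V w /\ preimage p B w).
split; [exact oA|]; split; [apply open_inter; auto|].
split; [exact As|]; split; [split; assumption|].
intros s' x' Ws' As' [Vx' Bx'].
destruct (AB s' (p x') As' Bx') as [Ns Hs].
destruct (proj2 (HN _ (toUs _ Hs)) Ns) as [w [[Uw Ow] Ew]].
destruct (tauP s' x' Ws') as [st' Ep'].
(* Both [w] and [tau s' x'] lie in the star of [x'] over the same point. *)
rewrite <- (overlay_star_inj _ _ _ _ x' w _ ovS); auto.
- exists V; split; [exact SV | split; [exact Vx' | apply Et, Uw]].
- congruence.
Qed.

Lemma tau_continuous s : W s -> continuous TX TX (tau s).
Proof.
intros Ws O oO; apply open_of_local; intros x Ox.
destruct (tau_joint_continuous s x O Ws oO Ox) as [A [B [_ [oB [As [Bx AB]]]]]].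
exists B; split; [exact oB | split; [exact Bx|]].
intros z Bz; exact (AB s z Ws As Bz).
Qed.

(** The multiplier [s] ranges over all of [Y], not only over [W], so that composites stay in the
    class. *)
Definition translation_lift (f : X -> X) : Prop :=
  continuous TX TX f /\ exists s, forall x, p (f x) = s * p x.

Lemma translation_lift_id : translation_lift (fun x => x).
Proof.
split; [apply continuous_id|].
exists (gone gY); intros x; now rewrite gmul1g.
Qed.

Lemma translation_lift_comp f f' :
  translation_lift f -> translation_lift f' -> translation_lift (fun x => f (f' x)).
Proof.
intros [cf [s Es]] [cf' [s' Es']]; split; [exact (continuous_comp _ _ cf cf')|].
exists (s * s'); intros x; now rewrite Es, Es', gmulA.
Qed.

Lemma translation_lift_tau s : W s -> translation_lift (tau s).
Proof.
intros Ws; split; [exact (tau_continuous s Ws)|].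
exists s; intros x; apply tauP, Ws.
Qed.

Lemma translation_lift_unique f f' a :
  translation_lift f -> translation_lift f' -> f a = f' a -> forall x, f x = f' x.
Proof.
intros [cf [s Es]] [cf' [s' Es']] Ea.
apply (covering_lift_unique TX TY TX p S f f' a (proj1 ovS) Xconn cf cf'); auto.
intros x; rewrite Es, Es'; f_equal.
(* The common value at [a] forces the two multipliers to be equal. *)
apply (gmul_right_inj gY _ _ (p a)); now rewrite <- Es, <- Es', Ea.
Qed.

Lemma translation_lift_transitive a b : exists f, translation_lift f /\ f a = b.
Proof.
(* Reachability from [a] spreads over stars. Since sharing a member of [S] is symmetric, both the
   reachable set and its complement are open. *)
assert (step : forall b b', star b S b' -> (exists f, translation_lift f /\ f a = b) ->
  exists f, translation_lift f /\ f a = b').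
{ intros c c' st [f [Lf Ef]].
  exists (fun x => tau (p c' * (p c)^-1) (f x)); split.
  - apply translation_lift_comp; [|exact Lf].
    apply translation_lift_tau, star_quotient, st.
  - rewrite Ef; apply tau_star, st. }
destruct ovS as [[sl [cov _]] _].
revert b.
apply (connected_clopen TX (fun b => exists f, translation_lift f /\ f a = b) a Xconn).
- apply open_of_local; intros b Hb.
  destruct (cov b) as [V [SV Vb]].
  exists V; split; [apply sl, SV | split; [exact Vb|]].
  intros c Vc; apply (step b); [exists V; auto | exact Hb].
- apply open_of_local; intros b Hb.
  destruct (cov b) as [V [SV Vb]].
  exists V; split; [apply sl, SV | split; [exact Vb|]].
  intros c Vc Hc; apply Hb, (step c); [exists V; auto | exact Hc].
- exists (fun x => x); split; [exact translation_lift_id | reflexivity].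
Qed.

(** * The group law *)

Section Law.
Context (e : X) (L : X -> X -> X) (R : X -> X -> X).
Hypothesis pe : p e = gone gY.
Hypothesis Llift : forall a, translation_lift (L a).
Hypothesis Le : forall a, L a e = a.
Hypothesis Rlift : forall a, translation_lift (R a).
Hypothesis Re : forall a, R a a = e.

Lemma law_comp a b x : L a (L b x) = L (L a b) x.
Proof.
apply (translation_lift_unique (fun x => L a (L b x)) (L (L a b)) e); auto.
- now apply translation_lift_comp.
- now rewrite !Le.
Qed.

Lemma law_unit x : L e x = x.
Proof.
apply (translation_lift_unique (L e) (fun x => x) e); auto.
exact translation_lift_id.
Qed.

(** [R a] and [L (R a e)] agree at [e], so [R a] is left multiplication by the inverse of [a]. *)
Lemma law_inv_l a : L (R a e) a = e.
Proof.
rewrite <- (Re a) at 2.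
apply (translation_lift_unique _ _ e); auto.
Qed.

Lemma law_inv_r a : L a (R a e) = e.
Proof.
(* The usual passage from left to right inverses: multiply on the left by [e], written as a left
   inverse of [R a e] times [R a e]. *)
rewrite <- (law_unit (L a (R a e))), <- (law_inv_l (R a e)) at 1.
now rewrite <- law_comp, (law_comp (R a e)), law_inv_l, law_unit, law_inv_l.
Qed.

Definition lifted_group : GroupStr X :=
  {| gmul := L; ginv := fun a => R a e; gone := e;
     gmulA := law_comp; gmul1g := law_unit; gmulg1 := Le;
     gmulVg := law_inv_l; gmulgV := law_inv_r |}.

(** Evaluating at [e], which lies over the unit, identifies the multiplier of [L a] as [p a]. *)
Lemma law_morph a b : p (L a b) = p a * p b.
Proof.
destruct (Llift a) as [_ [s Es]].
rewrite Es; f_equal.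
rewrite <- (gmulg1 gY s), <- pe, <- Es, Le; reflexivity.
Qed.

(* Near [a] one has [L a' = tau (p a' / p a) \o L a] and
   [R a' = R a \o tau (p a / p a')], so both operations inherit the joint
   continuity of [tau] at the unit. *)
Lemma lifted_group_topological : topological_group TX lifted_group.
Proof.
split.
- simpl; intros O a b oO Oab.
  destruct (tau_joint_continuous (gone gY) (L a b) O) as [A [B [oA [oB [A1 [Bab AB]]]]]];
    [exact (quotients_one a) | exact oO | now rewrite tau_one |].
  destruct (proj1 (proj2 (proj1 ovS)) a) as [V [SV Va]].
  exists (fun a' => V a' /\ A (p a' * (p a)^-1)), (preimage (L a) B).
  split; [apply open_inter|].
  { apply (proj1 (proj1 ovS)), SV. }
  { apply preimage_div_l_open, oA. }
  split; [apply (proj1 (Llift a)), oB|].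
  split; [split; [exact Va | now rewrite gmulgV]|].
  split; [exact Bab|].
  intros a' b' [Va' Aa'] Bb'.
  assert (st : star a S a') by (exists V; auto).
  assert (Ws := star_quotient _ _ st).
  rewrite (translation_lift_unique (L a') (fun x => tau (p a' * (p a)^-1) (L a x)) e).
  + apply AB; assumption.
  + apply Llift.
  + apply translation_lift_comp; [apply translation_lift_tau, Ws | apply Llift].
  + now rewrite !Le, tau_star.
- simpl; intros O oO; apply open_of_local; intros a Oa.
  destruct (tau_joint_continuous (gone gY) e (preimage (R a) O))
    as [A [B [oA [oB [A1 [Be AB]]]]]];
    [exact (quotients_one a) | apply (proj1 (Rlift a)), oO | now rewrite tau_one |].
  destruct (proj1 (proj2 (proj1 ovS)) a) as [V [SV Va]].
  exists (fun a' => V a' /\ A (p a * (p a')^-1)).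
  split; [apply open_inter|].
  { apply (proj1 (proj1 ovS)), SV. }
  { apply preimage_div_r_open, oA. }
  split; [split; [exact Va | now rewrite gmulgV]|].
  intros a' [Va' Aa'].
  assert (st : star a' S a) by (exists V; auto).
  assert (Ws := star_quotient _ _ st).
  unfold preimage.
  (* The lifts are compared at [a'], which [tau] moves to [a], so both give [e] there. *)
  rewrite (translation_lift_unique (R a') (fun x => R a (tau (p a * (p a')^-1) x)) a').
  + apply (AB _ e Ws Aa' Be).
  + apply Rlift.
  + apply translation_lift_comp; [apply Rlift | apply translation_lift_tau, Ws].
  + now rewrite tau_star, !Re.
Qed.

End Law.
End Lifts.

(** * Choice of the lifts and assembly of the group *)

Lemma functional_choice {A B : Type} (Q : A -> B -> Prop) :
  (forall a, exists b, Q a b) -> exists f, forall a, Q a (f a).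
Proof.
intros H.
exists (fun a => proj1_sig (constructive_indefinite_description _ (H a))).
intros a; apply proj2_sig.
Qed.

(** A translate of [U] contains both [p x] and [s] times it; the sheet through [x] above this
    translate is a member of [S] and maps onto it. *)
Lemma overlay_translation_lift {X Y : Type} (TX : Topology X) (TY : Topology Y)
    (gY : GroupStr Y) (p : X -> Y) (U : set Y) (S : set (set X)) (s : Y) (x : X) :
  overlay_structure TX TY p S ->
  (forall y, exists V, S V /\ set_eq (image p V) (rtranslate gY U y)) ->
  quotients gY U s ->
  exists x', star x S x' /\ p x' = gmul gY s (p x).
Proof.
intros [[_ [_ dec]] _] full Ws.
destruct (quotients_rtranslate gY U s (p x) Ws) as [z [Hx Hsx]].
destruct (full z) as [V [SV EV]].
destruct (dec V SV) as [J [Uj [SUj [_ [_ [un hom]]]]]].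
destruct (proj2 (un x) (proj2 (EV _) Hx)) as [j Ujx].
destruct (proj2 (proj2 (hom j) _) (proj2 (EV _) Hsx)) as [x' [Ujx' E]].
exists x'; split; [exists (Uj j); auto | exact E].
Qed.

Theorem theorem6p4 (X Y : Type) (TX : Topology X) (TY : Topology Y)
    (gY : GroupStr Y) (p : X -> Y) :
  topological_group TY gY ->
  continuous TX TY p ->
  surjective p ->
  connected TX ->
  (exists U : set Y, is_open TY U /\ U (gone gY) /\
     is_overlay_cover_translates TX TY p gY U) ->
  (exists S, overlay_structure TX TY p S /\ regular_overlay p S) ->
  exists gX : GroupStr X,
    topological_group TX gX /\
    forall a b, p (gmul gX a b) = gmul gY (p a) (p b).
Proof.
intros tgY pC psurj Xconn [U [oU [_ [S [ovS [S_image S_full]]]]]] _.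
destruct (psurj (gone gY)) as [e pe].
destruct (functional_choice (fun (sx : Y * X) x' => quotients gY U (fst sx) ->
  star (snd sx) S x' /\ p x' = gmul gY (fst sx) (p (snd sx)))) as [tau0 tau0P].
{ intros [s x]; simpl.
  destruct (classic (quotients gY U s)) as [Ws | nWs].
  - destruct (overlay_translation_lift TX TY gY p U S s x ovS S_full Ws) as [x' H].
    exists x'; auto.
  (* A default value outside the quotients, where the condition on [tau0] is vacuous. *)
  - exists x; tauto. }
set (tau := fun s x => tau0 (s, x)).
assert (tauP : forall s x, quotients gY U s ->
  star x S (tau s x) /\ p (tau s x) = gmul gY s (p x)) by (intros s x; apply (tau0P (s, x))).
assert (trans := translation_lift_transitive TX TY gY p U S tau
  tgY pC Xconn oU ovS S_image tauP).
destruct (functional_choice _ (trans e)) as [L HL].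
destruct (functional_choice _ (fun a => trans a e)) as [R HR].
assert (Llift := fun a => proj1 (HL a)); assert (Le := fun a => proj2 (HL a)).
assert (Rlift := fun a => proj1 (HR a)); assert (Re := fun a => proj2 (HR a)).
eexists; split.
- eapply lifted_group_topological with (L := L) (R := R); eassumption.
- intros a b; simpl; eapply law_morph; eassumption.
Unshelve. all: eassumption.
Qed.
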